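(* Let $\alpha,\beta,\lambda,\mu$ be real parameters such that $\alpha,\beta$ are not both zero and $\lambda,\mu$ are not both zero. Then, as formal power series in $t$, $$\frac{1}{\alpha}\,\mathrm{e}_{\frac{\beta}{\alpha}}\!\left[\alpha x\left(\frac{1}{\lambda}\mathrm{e}_{\frac{\mu}{\lambda}}(\lambda t)-\frac{1}{\lambda}\right)\right]-\frac{1}{\alpha}+\frac{\delta_{\alpha,1}}{\alpha} =\frac{\delta_{\alpha,1}}{\alpha}+\sum_{n=1}^\infty\sum_{k=1}^n\sum_{i=0}^{k-1}\sum_{j=0}^{n-k}\begin{bmatrix}n\\ n-j\end{bmatrix}\left\{\begin{matrix}n-j\\ k\end{matrix}\right\}\begin{bmatrix}k\\ k-i\end{bmatrix}\alpha^{k-1-i}\beta^i\lambda^{n-k-j}\mu^{j}x^k\frac{t^n}{n!}.$$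
   Context: The degenerate exponential is $\mathrm{e}_b(t)=(1-bt)^{-1/b}$ (with $\mathrm{e}_0(t)=e^t$), as a formal power series in $t$. Thus $\mathrm{e}_{\beta/\alpha}(\alpha y)=(1-\beta y)^{-\alpha/\beta}$. The case where a parameter equals zero is understood as a limit: $\mathrm{e}_{\beta/\alpha}(\alpha y)=e^{\alpha y}$ if $\beta=0$, and $\frac1\alpha\mathrm{e}_{\beta/\alpha}(\alpha y)-\frac1\alpha$ means $-\frac1\beta\log(1-\beta y)$ if $\alpha=0$; similarly with $(\lambda,\mu)$ in place of $(\alpha,\beta)$. $\delta_{\alpha,1}$ is the Kronecker delta ($1$ if $\alpha=1$, else $0$), and $\delta_{\alpha,1}/\alpha=0$ when $\alpha=0$. $\begin{bmatrix}n\\ k\end{bmatrix}$ denotes the unsigned Stirling number of the first kind (number of permutations of $n$ elements with $k$ cycles) and $\left\{\begin{matrix}n\\ k\end{matrix}\right\}$ the Stirling number of the second kind (number of partitions of an $n$-set into $k$ nonempty blocks). The convention $0^0=1$ is used. *)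

(* Defs.v *)
From HB Require Import structures.
From mathcomp Require Import all_boot all_order all_fingroup all_algebra.
From mathcomp Require Import boolp reals.

Set Implicit Arguments.
Unset Strict Implicit.
Unset Printing Implicit Defensive.

Import GRing.Theory.
Local Open Scope ring_scope.

(* Formal power series in t, represented by F n = the coefficient of t^n.
   Multiplication is the Cauchy product, not the pointwise one, which is why
   fps is a separate key for canonical structures. *)
Definition fps (A : Type) : Type := nat -> A.

Section FpsZmodule.
Variable A : zmodType.
Implicit Types F G H : fps A.

HB.instance Definition _ := gen_eqMixin (fps A).
HB.instance Definition _ := gen_choiceMixin (fps A).

Definition fps_zero : fps A := fun=> 0.
Definition fps_opp F : fps A := fun n => - F n.
Definition fps_add F G : fps A := fun n => F n + G n.

Fact fps_addA : associative fps_add.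
Proof. by move=> F G H; apply/funext=> n; rewrite /fps_add addrA. Qed.
Fact fps_addC : commutative fps_add.
Proof. by move=> F G; apply/funext=> n; rewrite /fps_add addrC. Qed.
Fact fps_add0 : left_id fps_zero fps_add.
Proof. by move=> F; apply/funext=> n; rewrite /fps_add add0r. Qed.
Fact fps_addN : left_inverse fps_zero fps_opp fps_add.
Proof. by move=> F; apply/funext=> n; rewrite /fps_add addNr. Qed.

HB.instance Definition _ :=
  GRing.isZmodule.Build (fps A) fps_addA fps_addC fps_add0 fps_addN.

End FpsZmodule.

Section FpsRing.
Variable A : comNzRingType.
Implicit Types F G H : fps A.

Definition fpsC (a : A) : fps A := fun n => if n == 0%N then a else 0.
Definition fpsX : fps A := fun n => (n == 1%N)%:R.
Definition fps_mul F G : fps A := fun n => \sum_(i < n.+1) F i * G (n - i)%N.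

Fact fps_mulE m F G n : (n < m)%N ->
  fps_mul F G n = ((\poly_(i < m) F i) * (\poly_(i < m) G i))`_n.
Proof.
move=> ltnm; rewrite coefM; apply: eq_bigr => i _; rewrite !coef_poly.
have lein : (i <= n)%N by rewrite -ltnS.
by rewrite (leq_ltn_trans lein ltnm) (leq_ltn_trans (leq_subr _ _) ltnm).
Qed.

Fact fps_mulC : commutative fps_mul.
Proof.
by move=> F G; apply/funext=> n; rewrite !(@fps_mulE n.+1) // mulrC.
Qed.

Fact fps_mulA : associative fps_mul.
Proof.
move=> F G H; apply/funext=> n; set p := fun K : fps A => \poly_(i < n.+1) K i.
transitivity ((p F * (p G * p H))`_n).
  rewrite /fps_mul coefM; apply: eq_bigr => i _.
  by rewrite coef_poly ltn_ord -fps_mulE // ltnS leq_subr.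
rewrite mulrA /fps_mul coefM; apply: eq_bigr => i _.
by rewrite [in X in _ * X]coef_poly ltnS leq_subr -fps_mulE.
Qed.

Fact fps_mul1 : left_id (fpsC 1) fps_mul.
Proof.
move=> F; apply/funext=> n; rewrite /fps_mul big_ord_recl /= mul1r subn0.
by rewrite big1 ?addr0 // => i _; rewrite /fpsC /= mul0r.
Qed.

Fact fps_mulDl : left_distributive fps_mul (@fps_add A).
Proof.
move=> F G H; apply/funext=> n; rewrite /fps_mul /fps_add -big_split /=.
by apply: eq_bigr => i _; rewrite mulrDl.
Qed.

Fact fps_one_neq0 : fpsC 1 != 0 :> fps A.
Proof. by apply/eqP => /(congr1 (@^~ 0%N)) /eqP; rewrite /fpsC /= oner_eq0. Qed.

HB.instance Definition _ := GRing.Zmodule_isComNzRing.Build (fps A)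
  fps_mulA fps_mulC fps_mul1 fps_mulDl fps_one_neq0.

End FpsRing.

Section FpsLmodule.
Variables (R : pzRingType) (A : lmodType R).
Implicit Types F G : fps A.

Definition fps_scale (a : R) F : fps A := fun n => a *: F n.

Fact fps_scaleA a b F : fps_scale a (fps_scale b F) = fps_scale (a * b) F.
Proof. by apply/funext=> n; rewrite /fps_scale scalerA. Qed.
Fact fps_scale1 : left_id 1 fps_scale.
Proof. by move=> F; apply/funext=> n; rewrite /fps_scale scale1r. Qed.
Fact fps_scaleDr : right_distributive fps_scale +%R.
Proof. by move=> a F G; apply/funext=> n; rewrite /fps_scale scalerDr. Qed.
Fact fps_scaleDl F : {morph fps_scale^~ F : a b / a + b}.
Proof. by move=> a b; apply/funext=> n; rewrite /fps_scale scalerDl. Qed.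

HB.instance Definition _ := GRing.Zmodule_isLmodule.Build R (fps A)
  fps_scaleA fps_scale1 fps_scaleDr fps_scaleDl.

End FpsLmodule.

(* Substitution F(y).  It is meaningful when y has zero constant term: then
   y ^+ k has no term below t^k, so stopping the sum at k = n drops nothing. *)
Definition fps_subst (R : comNzRingType) (A : comAlgType R)
    (F : fps R) (y : fps A) : fps A :=
  fun n => \sum_(k < n.+1) F k *: (y ^+ k) n.

Section DegenerateExponential.
Variable R : fieldType.

Definition fps_exp : fps R := fun n => (n`!%:R)^-1.

(* log(1 + t) *)
Definition fps_log1p : fps R :=
  fun n => if n is m.+1 then (-1) ^+ m / m.+1%:R else 0.

(* (1 + t)^a *)
Definition fps_binom (a : R) : fps R :=
  fun n => (\prod_(i < n) (a - i%:R)) / n`!%:R.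

Variable A : comAlgType R.

(* e_b(y) = (1 - b y)^(-1/b), and e_0(y) = exp(y) *)
Definition degexp (b : R) (y : fps A) : fps A :=
  if b == 0 then fps_subst fps_exp y
  else fps_subst (fps_binom (- b^-1)) (- (b *: y)).

(* (1/a) e_{b/a}(a y) - 1/a, read as -(1/b) log(1 - b y) when a = 0 *)
Definition degexpm1 (a b : R) (y : fps A) : fps A :=
  if a == 0 then - (b^-1 *: fps_subst fps_log1p (- (b *: y)))
  else a^-1 *: degexp (b / a) (a *: y) - a^-1 *: (1 : fps A).

End DegenerateExponential.

Definition stirling1 (n k : nat) : nat :=
  #|[set s : 'S_n | #|porbits s| == k]|.

Definition stirling2 (n k : nat) : nat :=
  #|[set P : {set {set 'I_n}} | partition P [set: 'I_n] & #|P| == k]|.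

(* Main.v *)
Require Import Defs.
From mathcomp Require Import all_boot all_order all_fingroup all_algebra.
From mathcomp Require Import boolp reals.
From mathcomp Require Import ring zify.

(* For all (a, b) <> (0, 0), the coefficient of y^k (k > 0) in
   (1/a) e_{b/a}(a y) - 1/a is prod_(1 <= i < k) (a + i b) / k!, and the rising
   product expands with Stirling numbers of the first kind.  It remains to
   expand the powers of g(t) = (1/l) e_{m/l}(l t) - 1/l: since
   (1 - m t) g' = 1 + l g, the numbers T(n, k) = n!/k! [t^n] g^k satisfy
     T(n+1, k+1) = T(n, k) + ((k+1) l + n m) T(n, k+1),
   and the recurrences of both kinds of Stirling numbers give the same
   recurrence for sum_j [n, n-j] {n-j, k} l^(n-k-j) m^j. *)

Set Implicit Arguments.
Unset Strict Implicit.
Unset Printing Implicit Defensive.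

Import GRing.Theory Num.Theory.
Local Open Scope ring_scope.

(** * Stirling numbers of the first kind: cycle counts and their recurrence *)

Lemma stirling1_sum n k :
  stirling1 n k = (\sum_(s : 'S_n) (#|porbits s| == k))%N.
Proof.
rewrite /stirling1 -sum1_card big_mkcond /=.
by apply: eq_bigr => s _; rewrite inE; case: ifP.
Qed.

Lemma lift_permX n (i : 'I_n.+1) (s : 'S_n) m :
  (lift_perm i i s ^+ m)%g = lift_perm i i (s ^+ m)%g.
Proof.
elim: m => [|m IHm]; first by rewrite !expg0 lift_perm1.
by rewrite !expgS IHm lift_permM.
Qed.

Lemma porbit_lift_perm_id n (i : 'I_n.+1) (s : 'S_n) :
  porbit (lift_perm i i s) i = [set i].
Proof.
apply/setP=> x; rewrite inE; apply/porbitP/eqP => [[m ->]|->]; last first.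
  by exists 0%N; rewrite expg0 perm1.
by rewrite lift_permX lift_perm_id.
Qed.

Lemma porbit_lift_perm_lift n (i : 'I_n.+1) (s : 'S_n) j :
  porbit (lift_perm i i s) (lift i j) = lift i @: porbit s j.
Proof.
apply/setP=> x; apply/porbitP/imsetP => [[m ->]|[y /porbitP[m ->] ->]].
  by exists ((s ^+ m)%g j); rewrite ?mem_porbit // lift_permX lift_perm_lift.
by exists m; rewrite lift_permX lift_perm_lift.
Qed.

(** The cycles of the lifted permutation are the fixed point [i] and the images under [lift i] of
    the cycles of [s]; none of these images contains [i]. *)
Lemma card_porbits_lift_perm n (i : 'I_n.+1) (s : 'S_n) :
  #|porbits (lift_perm i i s)| = #|porbits s|.+1.
Proof.
have -> : porbits (lift_perm i i s)
    = [set i] |: [set lift i @: A | A : {set 'I_n} in porbits s].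
  apply/setP=> B; rewrite !inE; apply/imsetP/orP => [[x _ ->]|].
    case: (unliftP i x) => [j ->|->]; last by left; rewrite porbit_lift_perm_id.
    by right; rewrite porbit_lift_perm_lift !imset_f.
  case=> [/eqP->|/imsetP[A /imsetP[j _ ->] ->]].
    by exists i; rewrite // porbit_lift_perm_id.
  by exists (lift i j); rewrite // porbit_lift_perm_lift.
rewrite cardsU1 (card_imset _ (imset_inj lift_inj)).
case: imsetP => // -[A _ /setP/(_ i)]; rewrite set11 => /esym/imsetP[j _].
by move/eqP; rewrite (negPf (neq_lift _ _)).
Qed.

(** Since [i] is alone in its cycle, a transposition with [j] different from [i] merges that cycle
    into the one of [j], undoing the gain of one cycle; for [i = j] the gain stays. *)
Lemma card_porbits_tperm_lift_perm n (i j : 'I_n.+1) (s : 'S_n) :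
  #|porbits (tperm i j * lift_perm i i s)| = (#|porbits s| + (i == j))%N.
Proof.
have := porbits_mul_tperm (lift_perm i i s) i j; cbv zeta.
rewrite porbit_sym porbit_lift_perm_id inE card_porbits_lift_perm eq_sym.
case: (i == j) => /=; first by rewrite !addn0 addn1.
by rewrite addn1 addn0 addn2 => -[].
Qed.

(* Every permutation of n+1 points is, in exactly one way, a permutation fixing
   0 preceded by a transposition (0 j). *)
Lemma tperm_lift_perm_bij n :
  bijective (fun p : 'I_n.+1 * 'S_n =>
    (tperm ord0 p.1 * lift_perm ord0 ord0 p.2)%g).
Proof.
apply: inj_card_bij; last by rewrite card_prod card_ord !card_Sn factS.
move=> [i s] [j t] /= eq_st.
have ij : i = j.
  have h (k : 'I_n.+1) u : (tperm ord0 k * lift_perm ord0 ord0 u)%g k = ord0.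
    by rewrite permM tpermR lift_perm_id.
  apply: (@perm_inj _ (tperm ord0 i * lift_perm ord0 ord0 s)%g).
  by rewrite h eq_st h.
move: eq_st; rewrite ij => /mulgI eq_st; congr (_, _).
apply/permP=> k; apply: (@lift_inj _ ord0).
by rewrite -!(lift_perm_lift ord0) eq_st.
Qed.

Lemma stirling1_0l k : stirling1 0 k = (k == 0)%N.
Proof.
rewrite stirling1_sum (eq_bigr (fun=> (k == 0)%N : nat)) => [|s _].
  by rewrite sum_nat_const card_Sn mul1n.
suff -> : porbits s = set0 by rewrite cards0 eq_sym.
by apply/setP=> B; rewrite inE; apply/imsetP=> -[[]].
Qed.

Lemma stirling1_S0 n : stirling1 n.+1 0 = 0%N.
Proof.
rewrite stirling1_sum big1 // => s _; case: eqP => // /eqP.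
by rewrite cards_eq0 => /eqP/setP/(_ (porbit s ord0)); rewrite imset_f ?inE.
Qed.

(** Sort the permutations by the transposition (0 j) split off from them: j = 0 adds a cycle, and
    each of the n other values of j leaves the number of cycles unchanged. *)
Lemma stirling1_SS n k :
  stirling1 n.+1 k.+1 = (n * stirling1 n k.+1 + stirling1 n k)%N.
Proof.
rewrite stirling1_sum (reindex _ (onW_bij _ (tperm_lift_perm_bij n))) /=.
rewrite -(pair_bigA _ (fun (i : 'I_n.+1) (s : 'S_n) =>
  nat_of_bool (#|porbits (tperm ord0 i * lift_perm ord0 ord0 s)| == k.+1))) /=.
rewrite big_ord_recl addnC; congr (_ + _)%N; last first.
  rewrite stirling1_sum; apply: eq_bigr => s _.
  by rewrite card_porbits_tperm_lift_perm eqxx addn1 eqSS.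
rewrite -[X in (X * _)%N]card_ord -sum_nat_const; apply: eq_bigr => i _.
rewrite stirling1_sum; apply: eq_bigr => s _.
by rewrite card_porbits_tperm_lift_perm addn0.
Qed.

Lemma stirling1_small n k : (n < k)%N -> stirling1 n k = 0%N.
Proof.
elim: n k => [|n IHn] [|k] // ltnk; first by rewrite stirling1_0l.
by rewrite stirling1_SS (IHn k) // (IHn k.+1) ?muln0 // ltnW.
Qed.

(** * Set partitions and Stirling numbers of the second kind *)

Section SetPartitions.
Variable T : finType.
Implicit Types (D B C : {set T}) (P Q : {set {set T}}).

(** An arbitrary ground set replaces ['I_n], so that the recurrence can remove a point without
    relabelling the others. *)
Definition npartitions D k := #|[set P | partition P D & #|P| == k]|.

(** A pair (Q, B) tells where the new point [x] goes: into the block B of Q, or into a block of its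
    own when B is empty. In [unglue], the final [:\ set0] discards what remains of the block of [x]
    if that block was a singleton. *)
Let glue x (p : {set {set T}} * {set T}) := (x |: p.2) |: (p.1 :\ p.2).
Let unglue x P :=
  let C := pblock P x in (((C :\ x) |: (P :\ C)) :\ set0, C :\ x).
Let pairs D := [set p : {set {set T}} * {set T} |
  partition p.1 D & (p.2 == set0) || (p.2 \in p.1)].

Lemma partition_setD1_set0 P D : partition P D -> P :\ set0 = P.
Proof.
case/and3P=> _ _ P0; apply/setP=> B; rewrite !inE.
by case: eqP => // ->; rewrite (negPf P0).
Qed.

Lemma glue_partition x D p : x \notin D -> p \in pairs D ->
  partition (glue x p) (x |: D) /\ #|glue x p| = (#|p.1| + (p.2 == set0))%N.
Proof.
case: p => Q B xD; rewrite inE /= => /andP[partQ QB].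
have partQB : partition (Q :\ B) (D :\: B).
  case/orP: QB => [/eqP->|]; last exact: partitionD1.
  by rewrite (partition_setD1_set0 partQ) setD0.
have sBD : B \subset D.
  case/orP: QB => [/eqP->|QB]; first exact: sub0set.
  by rewrite -(cover_partition partQ); apply: (bigcup_sup B).
have part : partition (glue x (Q, B)) (x |: D).
  suff -> : x |: D = (x |: B) :|: (D :\: B).
    apply: partitionU1 => //; first by apply/set0Pn; exists x; rewrite setU11.
    rewrite -setI_eq0; apply/eqP/setP=> y; rewrite !inE.
    by case: eqP => [->|_]; rewrite ?(negPf xD) ?andbF //; case: (y \in B).
  rewrite -setUA; congr (_ :|: _); apply/setP=> y; rewrite !inE.
  by case yB: (y \in B); rewrite //= (subsetP sBD).
split=> //; rewrite /glue /= cardsU1 inE.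
(* The blocks of [Q] lie in [D], which does not contain [x], so the enlarged block is new. *)
have -> : x |: B \in Q = false.
  apply/negP => QxB; move: xD; rewrite -(cover_partition partQ) => /negP[].
  by apply/bigcupP; exists (x |: B); rewrite // setU11.
rewrite andbF /= add1n.
case/orP: QB => [/eqP->|QB].
  by rewrite (partition_setD1_set0 partQ) eqxx addn1.
have -> : B == set0 = false.
  by apply/eqP => B0; case/and3P: partQ => _ _; rewrite -B0 QB.
by rewrite addn0 (cardsD1 B Q) QB.
Qed.

Lemma glueK x D p : x \notin D -> p \in pairs D -> unglue x (glue x p) = p.
Proof.
move=> xD pD; have [part _] := glue_partition xD pD.
case: p pD part => Q B; rewrite inE /= => /andP[partQ QB] part.
have sBD : B \subset D.
  case/orP: QB => [/eqP->|QB]; first exact: sub0set.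
  by rewrite -(cover_partition partQ); apply: (bigcup_sup B).
have xB : x \notin B by apply: contra xD; apply: subsetP.
have E : pblock (glue x (Q, B)) x = x |: B.
  case/and3P: part => _ triv _; apply: def_pblock => //; last exact: setU11.
  exact: setU11.
have xBQ : x |: B \notin Q.
  apply/negP => QxB; move: xD; rewrite -(cover_partition partQ) => /negP[].
  by apply/bigcupP; exists (x |: B); rewrite // setU11.
rewrite /unglue E /glue /= !setU1K //; last by rewrite !inE negb_and xBQ orbT.
(* Putting [B] back and deleting [set0] restores [Q] both when [B] is a block and when it is
   empty. *)
congr (_, _); apply/setP=> C; rewrite !inE; case: eqP => [->|C0] /=.
  by case/and3P: partQ => _ _ /negPf.
case: eqP => [CB|] //=.
by case/orP: QB => [/eqP B0|]; [rewrite B0 in CB|rewrite CB => ->].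
Qed.

Lemma unglue_pairs x D P : x \notin D -> partition P (x |: D) ->
  unglue x P \in pairs D /\ glue x (unglue x P) = P.
Proof.
move=> xD part; set C := pblock P x.
have xP : x \in cover P by rewrite (cover_partition part) setU11.
have PC : C \in P by rewrite pblock_mem.
have xC : x \in C by rewrite mem_pblock.
have partPC := partitionD1 part PC.
have sCD : C \subset x |: D.
  by rewrite -(cover_partition part); apply: (bigcup_sup C).
have glueE : glue x (unglue x P) = P.
  rewrite /glue /unglue /= -/C setD1K //; apply/setP=> B; rewrite !inE.
  case: (B =P C) => [->|BC] //=; case: eqP => [BE|BE] /=.
    (* [C :\ x] is not a block of [P]: such a block would be nonempty and meet [C], hence equal
       [C]. *)
    apply/esym/negP => PB; apply: BC.
    have [y yB] : exists y, y \in B.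
      by apply/set0Pn; case/and3P: part => _ _; apply: contra => /eqP<-.
    case/and3P: part => _ triv _; rewrite -(def_pblock triv PB yB).
    by apply: def_pblock => //; move: yB; rewrite BE inE => /andP[].
  by case: eqP => // ->; case/and3P: part => _ _ /negPf.
split=> //; rewrite inE /= -/C.
(* Either [x] was a singleton block, which disappears, or [C :\ x] is a block of the new partition
   of [D]. *)
have [C0|C0] := eqVneq (C :\ x) set0.
  have CE : C = [set x] by rewrite -(setD1K xC) C0 setU0.
  rewrite C0 setU1K ?orbF; last first.
    by rewrite !inE; apply/nandP; right; case/and3P: part.
  by rewrite andbT; move: partPC; rewrite {2}CE setU1K.
have -> : D = (C :\ x) :|: ((x |: D) :\: C).
  apply/setP=> y; rewrite !inE; have := subsetP sCD y; rewrite !inE.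
  case: eqP => [->|_] /=; first by rewrite xC (negPf xD).
  by case: (y \in C) => // ->.
have partU : partition (C :\ x |: P :\ C) ((C :\ x) :|: ((x |: D) :\: C)).
  apply: partitionU1 => //; rewrite -setI_eq0; apply/eqP/setP=> y.
  by rewrite !inE; case: (y \in C); rewrite ?andbF.
by rewrite (partition_setD1_set0 partU) partU setU11.
Qed.

Lemma npartitions_set0 k : npartitions set0 k = (k == 0)%N.
Proof.
rewrite /npartitions; case: eqP => [->|k0].
  apply/eqP/cards1P; exists set0; apply/setP=> P.
  by rewrite !inE partition_set0 cards_eq0 andbb.
apply/eqP; rewrite cards_eq0; apply/eqP/setP=> P; rewrite !inE partition_set0.
by apply/andP => -[/eqP->]; rewrite cards0 => /eqP/esym.
Qed.

(** Count the pairs (Q, B) that [glue] turns into k+1 blocks. If Q has k blocks, B must be empty; if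
    Q has k+1 blocks, B is any one of them; no other Q contributes. *)
Lemma npartitions_setU1 x D k : x \notin D ->
  npartitions (x |: D) k.+1
  = (npartitions D k + k.+1 * npartitions D k.+1)%N.
Proof.
move=> xD.
have -> : npartitions (x |: D) k.+1
  = #|[set p in pairs D | (#|p.1| + (p.2 == set0) == k.+1)%N]|.
  rewrite /npartitions; set S := [set p in pairs D | _].
  have <- : #|glue x @: S| = #|S|.
    apply: card_in_imset => p q; rewrite !inE => /andP[pD _] /andP[qD _] E.
    by rewrite -(@glueK x D p) ?inE // E (@glueK x D) ?inE.
  apply: eq_card => P; rewrite !inE; apply/andP/imsetP.
    case=> part /eqP cardP; have [pD glueE] := unglue_pairs xD part.
    exists (unglue x P) => //; rewrite inE pD.
    by have [_ <-] := glue_partition xD pD; rewrite glueE cardP eqxx.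
  case=> p; rewrite inE => /andP[pD /eqP pk] ->.
  by have [-> ->] := glue_partition xD pD; rewrite pk.
rewrite -sum1_card.
transitivity (\sum_(Q | partition Q D)
   \sum_(B | ((B == set0) || (B \in Q)) && (#|Q| + (B == set0) == k.+1)) 1)%N.
  rewrite pair_big_dep /=; apply: eq_bigl => p.
  by rewrite !inE -andbA.
rewrite /npartitions -!sum1_card big_distrr /= !big_mkcond /=.
rewrite [X in _ = (X + _)%N]big_mkcond [X in _ = (_ + X)%N]big_mkcond.
rewrite -big_split; apply: eq_bigr => Q _; rewrite !inE.
case: ifP => //= partQ; rewrite sum1_card.
have Q0 : set0 \notin Q by case/and3P: partQ.
have [Qk|Qk] := eqVneq #|Q| k.
  rewrite Qk ltn_eqF // addn0; apply/eqP/eqP => /=.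
  rewrite -(cards1 (set0 : {set T})); apply: eq_card => B.
  rewrite !inE unfold_in.
  by case: eqP => [->|_] /=; rewrite ?addn1 ?eqxx // addn0 ltn_eqF // andbF.
have [Qk1|Qk1] := eqVneq #|Q| k.+1.
  rewrite add0n muln1 -Qk1; apply: eq_card => B; rewrite unfold_in.
  case: eqP => [->|_] /=; last by rewrite addn0 eqxx andbT.
  by rewrite addn1 gtn_eqF // (negPf Q0).
apply: eq_card0 => B; rewrite unfold_in.
case: eqP => _ /=;
  by rewrite ?addn1 ?eqSS ?addn0 ?(negPf Qk) ?(negPf Qk1) ?andbF.
Qed.

Lemma npartitions_setU1_0 x D : npartitions (x |: D) 0 = 0%N.
Proof.
apply/eqP; rewrite cards_eq0; apply/eqP/setP=> P; rewrite !inE cards_eq0.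
apply/andP => -[/cover_partition/setP/(_ x) + /eqP P0].
by rewrite P0 setU11 => /bigcupP[C]; rewrite inE.
Qed.

End SetPartitions.

(** Induction on the common cardinal: remove one point from each set and apply the same recurrence
    to both counts. *)
Lemma eq_npartitions (T U : finType) (D : {set T}) (E : {set U}) k :
  #|D| = #|E| -> npartitions D k = npartitions E k.
Proof.
move En: #|D| => n /esym; elim: n D E k En => [|n IHn] D E k cD cE.
  move/eqP: cD; rewrite cards_eq0 => /eqP->; move/eqP: cE.
  by rewrite cards_eq0 => /eqP->; rewrite !npartitions_set0.
have [x xD] : exists x, x \in D by apply/card_gt0P; rewrite cD.
have [y yE] : exists y, y \in E by apply/card_gt0P; rewrite cE.
move: cD; rewrite (cardsD1 x) xD add1n => -[cD].
move: cE; rewrite (cardsD1 y) yE add1n => -[cE].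
rewrite -(setD1K xD) -(setD1K yE); case: k => [|k].
  by rewrite !npartitions_setU1_0.
by rewrite !npartitions_setU1 ?setD11 // !(IHn _ _ _ cD cE).
Qed.

Lemma stirling2_0l k : stirling2 0 k = (k == 0)%N.
Proof.
rewrite -(npartitions_set0 'I_0); apply: eq_npartitions.
by rewrite cardsT card_ord cards0.
Qed.

Lemma setT_ordS n : [set: 'I_n.+1] = ord0 |: [set~ ord0].
Proof. by rewrite setUCr. Qed.

Lemma stirling2_S0 n : stirling2 n.+1 0 = 0%N.
Proof.
by rewrite /stirling2 setT_ordS -/(npartitions _ _) npartitions_setU1_0.
Qed.

Lemma stirling2_SS n k :
  stirling2 n.+1 k.+1 = (stirling2 n k + k.+1 * stirling2 n k.+1)%N.
Proof.
have E m : npartitions [set~ ord0 : 'I_n.+1] m = stirling2 n m.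
  by apply: eq_npartitions; rewrite cardsC1 cardsT !card_ord.
by rewrite {1}/stirling2 setT_ordS -/(npartitions _ _) npartitions_setU1 ?E ?inE
  ?eqxx.
Qed.

Lemma stirling2_small n k : (n < k)%N -> stirling2 n k = 0%N.
Proof.
elim: n k => [|n IHn] [|k] // ltnk; first by rewrite stirling2_0l.
by rewrite stirling2_SS (IHn k) // (IHn k.+1) ?muln0 // ltnW.
Qed.

(** * Polynomials built from the Stirling numbers *)

Section StirlingPolynomials.
Variable R : comNzRingType.
Implicit Types a b : R.

(** The product starts at i = 1: the factor [a] is already divided out, so the formula also makes
    sense for a = 0. *)
Definition rising a b k : R := \prod_(1 <= i < k) (a + b *+ i).

(** The new factor [a + b *+ k.+1] mirrors the recurrence of the first kind: its term in [a] shifts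
    m, its term in [b] keeps m. *)
Lemma rising_stirling1 a b k :
  rising a b k.+1
  = \sum_(m < k.+1) (stirling1 k.+1 m.+1)%:R * a ^+ m * b ^+ (k - m).
Proof.
elim: k => [|k IHk].
  rewrite /rising big_geq // big_ord_recl big_ord0 stirling1_SS !stirling1_0l.
  by rewrite addr0 !mulr1.
rewrite /rising big_nat_recr //= -/(rising a b k.+1) IHk.
under [RHS]eq_bigr do rewrite stirling1_SS natrD natrM 2!mulrDl.
rewrite big_split /= mulrDr addrC; congr (_ + _).
  rewrite [RHS]big_ord_recl /= stirling1_S0 !mul0r add0r big_distrl /=.
  by apply: eq_bigr => i _; rewrite /bump /= add1n subSS exprS; ring.
rewrite [RHS]big_ord_recr /= (stirling1_small (ltnSn _)) mulr0 !mul0r addr0.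
rewrite big_distrl; apply: eq_bigr => i _ /=.
rewrite subSn ?exprS; last by rewrite -ltnS.
by rewrite -mulr_natl; ring.
Qed.

(** The sum over j of the theorem, indexed by m = n - j. For m < k the truncated exponent [m - k] is
    harmless because {m, k} = 0. *)
Definition stirling12 a b n k : R :=
  \sum_(m < n.+1) (stirling1 n m)%:R * (stirling2 m k)%:R
    * a ^+ (m - k) * b ^+ (n - m).

Lemma stirling12_0l a b k : stirling12 a b 0 k = (k == 0)%N%:R.
Proof.
rewrite /stirling12 big_ord_recl big_ord0 stirling1_0l stirling2_0l.
by rewrite mul1r !mulr1 addr0.
Qed.

Lemma stirling12_S0 a b n : stirling12 a b n.+1 0 = 0.
Proof.
rewrite /stirling12 big1 // => -[[|m] _] _ /=.
  by rewrite stirling1_S0 !mul0r.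
by rewrite stirling2_S0 mulr0 !mul0r.
Qed.

(** The recurrence of the first kind applied to [n+1, m+1] splits off the term in [b *+ n]; that of
    the second kind ([E]) then splits {m+1, k+1} in the rest, giving the other two terms. *)
Lemma stirling12_SS a b n k :
  stirling12 a b n.+1 k.+1
  = stirling12 a b n k + (a *+ k.+1 + b *+ n) * stirling12 a b n k.+1.
Proof.
have E m : (stirling2 m.+1 k.+1)%:R * a ^+ (m - k)
  = (stirling2 m k)%:R * a ^+ (m - k)
    + (a *+ k.+1) * ((stirling2 m k.+1)%:R * a ^+ (m - k.+1)).
  rewrite stirling2_SS natrD natrM mulrDl; congr (_ + _).
  (* For m <= k the exponent [m - k.+1] is truncated, but its coefficient {m, k+1} vanishes. *)
  have [km|mk] := ltnP k m; last by rewrite stirling2_small // !(mulr0, mul0r).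
  by rewrite -(subSS k m) subSn // exprS -mulr_natl; ring.
rewrite /stirling12 big_ord_recl /= stirling1_S0 !mul0r add0r.
rewrite mulrDl addrA.
transitivity (\sum_(m < n.+1)
   ((stirling1 n m)%:R * (stirling2 m.+1 k.+1)%:R * a ^+ (m - k) * b ^+ (n - m)
   + b *+ n * ((stirling1 n m.+1)%:R * (stirling2 m.+1 k.+1)%:R
       * a ^+ (m - k) * b ^+ (n - m.+1)))).
  apply: eq_bigr => i _; rewrite /bump /= add1n !subSS stirling1_SS natrD natrM.
  (* At i = n the exponent [n - i.+1] is truncated, but [n, n+1] = 0. *)
  have [lt_in|ge_in] := ltnP i n.
    by rewrite -(subSS i n) subSn // exprS -mulr_natl; ring.
  rewrite (@stirling1_small n i.+1) //; ring.
rewrite big_split /=; congr (_ + _); last first.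
  rewrite -mulr_sumr; congr (_ * _).
  rewrite big_ord_recr /= (stirling1_small (ltnSn n)) !mul0r addr0.
  rewrite [RHS]big_ord_recl /= (stirling2_small (ltn0Sn k)) mulr0.
  by rewrite !mul0r add0r.
rewrite [in RHS]mulr_sumr -big_split; apply: eq_bigr => i _ /=.
rewrite -(mulrA _ (stirling2 _.+1 _)%:R) E; ring.
Qed.
End StirlingPolynomials.

(** * Formal power series: the Euler operator and coefficients of products *)

Section FpsTheory.
Variable A : comNzRingType.
Implicit Types F G : fps A.

(** The operator t d/dt, a derivation that, unlike d/dt, does not shift coefficients. *)
Definition euler F : fps A := fun n => F n *+ n.

Lemma eulerM F G : euler (F * G) = euler F * G + F * euler G.
Proof.
apply/funext=> n; rewrite /euler /GRing.add /= /fps_add /GRing.mul /= /fps_mul.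
rewrite -sumrMnl -big_split; apply: eq_bigr => i _ /=.
by rewrite mulrnAl mulrnAr -mulrnDr subnKC // -ltnS.
Qed.

Lemma eulerXn F k : euler (F ^+ k.+1) = (F ^+ k * euler F) *+ k.+1.
Proof.
elim: k => [|k IHk]; first by rewrite expr1 expr0 mul1r mulr1n.
by rewrite exprS eulerM IHk mulrnAr mulrA -exprS [euler F * _]mulrC -mulrS.
Qed.

Lemma coef_fpsMn F m n : (F *+ m) n = F n *+ m.
Proof. by elim: m => // m IHm; rewrite !mulrS -IHm. Qed.

Lemma coef_fpsXM F n : (fpsX A * F) n = if n is m.+1 then F m else 0.
Proof.
rewrite /GRing.mul /= /fps_mul; case: n => [|n].
  by rewrite big_ord_recl big_ord0 mul0r addr0.
rewrite 2!big_ord_recl big1 => [|i _]; last by rewrite /fpsX /= mul0r.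
by rewrite /fpsX /= mul0r mul1r add0r addr0 subSS subn0.
Qed.

Lemma coef_fpsCM (c : A) F n : (fpsC c * F) n = c * F n.
Proof.
rewrite /GRing.mul /= /fps_mul big_ord_recl big1 => [|i _].
  by rewrite addr0 /fpsC subn0.
by rewrite /fpsC /= mul0r.
Qed.

Lemma fpsCXn (c : A) k : (fpsC c : fps A) ^+ k = fpsC (c ^+ k).
Proof.
elim: k => // k IHk; rewrite exprS IHk; apply/funext=> n.
by rewrite coef_fpsCM /fpsC; case: ifP => _; rewrite ?mulr0 // exprS.
Qed.

Lemma coef_fpsXn k n : (fpsX A ^+ k) n = (n == k)%:R.
Proof.
elim: k n => [|k IHk] n; first by case: n.
by rewrite exprS coef_fpsXM; case: n.
Qed.

End FpsTheory.

Section FpsAlgebra.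
Variables (R : comNzRingType) (A : comAlgType R).
Implicit Types F G : fps A.

Lemma coef_fpsZ (a : R) F n : (a *: F) n = a *: F n.
Proof. by []. Qed.

Lemma fps_scalerAl (a : R) F G : a *: (F * G) = (a *: F) * G.
Proof.
apply/funext=> n; rewrite /GRing.scale /= /fps_scale /GRing.mul /= /fps_mul.
by rewrite scaler_sumr; apply: eq_bigr => i _; rewrite scalerAl.
Qed.

Lemma fps_exprZn (a : R) F k : (a *: F) ^+ k = a ^+ k *: F ^+ k.
Proof.
elim: k => [|k IHk]; first by rewrite !expr0 scale1r.
rewrite !exprS IHk -fps_scalerAl [F * _]mulrC -fps_scalerAl scalerA.
by rewrite [F * _]mulrC.
Qed.

End FpsAlgebra.

(** * Coefficients of the degenerate exponential and of its powers *)

Section DegenerateExponential.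
Variables (R : numFieldType) (A : comAlgType R).
Implicit Types (a b : R) (y : fps A).

Lemma natf_fact_neq0 n : n`!%:R != 0 :> R.
Proof. by rewrite pnatr_eq0 -lt0n fact_gt0. Qed.

Lemma mulr_rising a b k : a * rising a b k.+1 = \prod_(i < k.+1) (a + b *+ i).
Proof. by rewrite big_ord_recl mulr0n addr0 /rising big_add1 big_mkord. Qed.

(** The three cases a = 0, b = 0 and both nonzero use the logarithmic, exponential and binomial
    series. In the last two the constant term cancels against 1/a. *)
Lemma coef_degexpm1 a b y n : ~ (a = 0 /\ b = 0) ->
  degexpm1 a b y n
  = \sum_(k < n) (rising a b k.+1 / k.+1`!%:R) *: (y ^+ k.+1) n.
Proof.
rewrite /degexpm1 /degexp; have [->|a0] := eqVneq a 0 => ab0.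
  have b0 : b != 0 by apply/eqP => b0; apply: ab0.
  rewrite -scalerN -scaleNr.
  transitivity (b^-1 *: - fps_subst (@fps_log1p R) (- b *: y) n) => //.
  rewrite /fps_subst big_ord_recl /= scale0r add0r -sumrN scaler_sumr.
  apply: eq_bigr => k _; rewrite /bump /= add1n fps_exprZn -scaleNr scalerA.
  rewrite coef_fpsZ scalerA; congr (_ *: _).
  have -> : rising 0 b k.+1 = b ^+ k * k`!%:R.
    rewrite /rising big_add1 big_mkord; elim: {k}(k : nat) => [|k IHk] /=.
      by rewrite big_ord0 mulr1.
    by rewrite big_ord_recr IHk /= factS natrM exprS add0r -mulr_natl; ring.
  (* The signs of the logarithm, of the power of [- b] and of the outer minus cancel; splitting on
     the parity of [k] makes this visible to [field]. *)
  rewrite ?add0n factS natrM [(- b) ^+ _]exprNn ![_ ^+ k.+1]exprS -signr_odd.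
  by case: (odd k); field; rewrite natf_fact_neq0 nat1r pnatr_eq0 b0.
rewrite mulf_eq0 invr_eq0 (negPf a0) orbF.
have [->|b0] := eqVneq b 0.
  transitivity (a^-1 *: (fps_subst (fps_exp R) (a *: y) n - (1 : fps A) n)).
    by rewrite scalerBr.
  rewrite /fps_subst big_ord_recl /= expr0 /fps_exp fact0 invr1 scale1r.
  rewrite addrAC subrr add0r scaler_sumr; apply: eq_bigr => k _.
  rewrite /bump /= add1n fps_exprZn.
  rewrite coef_fpsZ !scalerA; congr (_ *: _).
  rewrite /rising (eq_bigr (fun=> a)) => [|i _]; last by rewrite mul0rn addr0.
  rewrite prodr_const_nat subn1 exprS /=.
  by field; rewrite a0 natf_fact_neq0.
transitivity (a^-1 *: (fps_subst (fps_binom (- (b / a)^-1))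
  (- (b / a *: (a *: y))) n - (1 : fps A) n)).
  by rewrite scalerBr.
rewrite /fps_subst big_ord_recl /= expr0 /fps_binom big_ord0 fact0.
rewrite divr1 scale1r.
rewrite addrAC subrr add0r scaler_sumr; apply: eq_bigr => k _.
rewrite /bump /= add1n scalerA divfK // -scaleNr fps_exprZn.
rewrite coef_fpsZ !scalerA; congr (_ *: _).
(* Each factor -a/b - i of the binomial coefficient, times -b, is a + i b; the factor i = 0 accounts
   for the division by [a]. *)
have -> : rising a b k.+1
  = a^-1 * (\prod_(i < k.+1) (- (b / a)^-1 - i%:R) * (- b) ^+ k.+1).
  rewrite -[X in _ ^+ X]card_ord -prodr_const -big_split /=.
  apply: (mulfI a0); rewrite mulr_rising mulrA divff // mul1r.
  by apply: eq_bigr => i _; rewrite -mulr_natr; field; rewrite a0 b0.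
by field; rewrite a0 natf_fact_neq0.
Qed.

Lemma coef_degexpm1_fpsX a b n : ~ (a = 0 /\ b = 0) ->
  degexpm1 a b (fpsX A) n
  = if n is m.+1 then (rising a b n / n`!%:R) *: 1 else 0.
Proof.
move=> ab0; rewrite coef_degexpm1 //; case: n => [|n].
  by rewrite big_ord0.
rewrite big_ord_recr /= coef_fpsXn eqxx big1 ?add0r // => i _.
by rewrite coef_fpsXn eqSS gtn_eqF // scaler0.
Qed.

(* This is (1 - b t) g' = 1 + a g, multiplied by t. *)
Lemma euler_degexpm1_fpsX a b : ~ (a = 0 /\ b = 0) ->
  let g := degexpm1 a b (fpsX A) in
  euler g = fpsX A * (1 + a *: g + b *: euler g).
Proof.
move=> ab0 g; apply/funext=> -[|n]; rewrite coef_fpsXM.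
  by rewrite /euler mulr0n.
rewrite {1}/euler {1}/g coef_degexpm1_fpsX //.
transitivity ((n == 0)%:R + a *: g n + b *: (g n *+ n)); last by case: n.
rewrite /g coef_degexpm1_fpsX //; case: n => [|n].
  by rewrite mulr0n !scaler0 !addr0 /rising big_geq // divr1 scale1r.
rewrite /= add0r -!scaler_nat !scalerA -scalerDl; congr (_ *: _).
rewrite {1}/rising big_nat_recr // -/(rising a b n.+1).
rewrite factS natrM /= -mulr_natl.
by field; rewrite natf_fact_neq0 -natrD pnatr_eq0.
Qed.

(** Induction on n for all k at once: the differential equation of g turns into the recurrence
    [stirling12_SS]. *)
Lemma coef_degexpm1_fpsX_exp a b n k : ~ (a = 0 /\ b = 0) ->
  (degexpm1 a b (fpsX A) ^+ k) n
  = (k`!%:R / n`!%:R * stirling12 a b n k) *: 1.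
Proof.
move=> ab0; set g := degexpm1 a b (fpsX A).
elim: n k => [|n IHn] k.
  rewrite stirling12_0l; case: k => [|k].
    by rewrite expr0 divr1 mulr1 scale1r.
  rewrite mulr0 scale0r exprS /GRing.mul /= /fps_mul big_ord_recl big_ord0.
  by rewrite {1}/g coef_degexpm1_fpsX // mul0r addr0.
case: k => [|k]; first by rewrite expr0 stirling12_S0 mulr0 scale0r.
have nS0 : n.+1%:R != 0 :> R by rewrite pnatr_eq0.
(* Multiplying by n+1 produces a coefficient of [euler (g ^+ k.+1)]. *)
apply: (scalerI nS0).
have := congr1 (@^~ n.+1) (eulerXn g k).
rewrite {1}/euler -scaler_nat => ->.
(* Insert the differential equation once and fold (k+1) g^k [euler g] back into [euler (g ^+ k.+1)].
   The factor [fpsX] lowers the degree, so only coefficients of t^n remain, where [IHn] applies. *)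
have -> : (g ^+ k * euler g) *+ k.+1
  = fpsX A * ((g ^+ k + a *: g ^+ k.+1) *+ k.+1 + b *: euler (g ^+ k.+1)).
  rewrite eulerXn {1}euler_degexpm1_fpsX // -/g.
  rewrite (mulrCA (g ^+ k)) -[LHS]mulrnAr; congr (_ * _).
  rewrite mulrDr mulrDr mulr1 mulrnDl; congr (_ *+ _ + _).
    by rewrite mulrC -fps_scalerAl -exprS.
  by rewrite mulrC -fps_scalerAl mulrC scalerMnr.
rewrite coef_fpsXM.
transitivity (((g ^+ k + a *: g ^+ k.+1) *+ k.+1) n
  + b *: ((g ^+ k.+1) n *+ n)); first by reflexivity.
rewrite coef_fpsMn.
transitivity (((g ^+ k) n + a *: (g ^+ k.+1) n) *+ k.+1
  + b *: ((g ^+ k.+1) n *+ n)); first by reflexivity.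
rewrite !IHn stirling12_SS -!scaler_nat !(scalerA, scalerDr) -!scalerDl.
congr (_ *: _); rewrite (factS k) (factS n) !natrM.
rewrite -(mulr_natl a) -(mulr_natl b).
move: (natf_fact_neq0 n) nS0.
move: (stirling12 _ _ n k) (stirling12 _ _ n k.+1).
move: k.+1%:R n.+1%:R n%:R k`!%:R n`!%:R => K N n' p q S S' q0 N0.
by field; rewrite q0.
Qed.

End DegenerateExponential.

(** * Reindexed Stirling sums and the triple-sum expansion *)

Lemma rising_rev (R : comNzRingType) (a b : R) k :
  rising a b k.+1
  = \sum_(0 <= i < k.+1) (stirling1 k.+1 (k.+1 - i))%:R * a ^+ (k - i) * b ^+ i.
Proof.
rewrite rising_stirling1 big_mkord (reindex_inj rev_ord_inj) /=.
by apply: eq_bigr => i _; rewrite subSS -subSn ?subKn // -ltnS.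
Qed.

(** Put m = n - j; the terms with j > n - k vanish, since then n - j < k and {n-j, k} = 0. *)
Lemma stirling12_rev (R : comNzRingType) (a b : R) n k : (k <= n)%N ->
  stirling12 a b n k
  = \sum_(0 <= j < (n - k).+1) (stirling1 n (n - j))%:R
      * (stirling2 (n - j) k)%:R * a ^+ (n - k - j) * b ^+ j.
Proof.
move=> lekn; rewrite /stirling12 (reindex_inj rev_ord_inj) /=.
rewrite -(big_mkord xpredT (fun j => (stirling1 n (n.+1 - j.+1))%:R
  * (stirling2 (n.+1 - j.+1) k)%:R * a ^+ (n.+1 - j.+1 - k)
  * b ^+ (n - (n.+1 - j.+1)))).
rewrite (big_cat_nat (n := (n - k).+1)) //=; last by rewrite ltnS leq_subr.
rewrite [X in _ + X]big_nat.
rewrite [X in _ + X]big1 => [|j /andP[lt_j le_j]]; last first.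
  rewrite subSS stirling2_small ?mulr0 ?mul0r //.
  lia.
rewrite addr0; apply: eq_big_nat => j /andP[_ le_j].
have lejn : (j <= n)%N by lia.
by rewrite subSS subKn // subnAC.
Qed.

Unset Implicit Arguments.

Theorem theorem4p4 (R : realType) (alpha beta lambda mu : R)
    (hab : ~ (alpha = 0 /\ beta = 0)) (hlm : ~ (lambda = 0 /\ mu = 0)) :
  degexpm1 alpha beta
      (fpsC ('X : {poly R}) * degexpm1 lambda mu (fpsX {poly R}))
    + ((alpha == 1)%:R / alpha) *: (1 : fps {poly R})
  = ((alpha == 1)%:R / alpha) *: (1 : fps {poly R})
    + ((fun n : nat =>
          if n == 0%N then 0 else
          (n`!%:R)^-1 *:
          \sum_(1 <= k < n.+1) \sum_(0 <= i < k) \sum_(0 <= j < (n - k).+1)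
            ((stirling1 n (n - j))%:R * (stirling2 (n - j) k)%:R
             * (stirling1 k (k - i))%:R
             * alpha ^+ (k - 1 - i) * beta ^+ i
             * lambda ^+ (n - k - j) * mu ^+ j) *: 'X^k) : fps {poly R}).
Proof.
rewrite addrC; congr (_ + _); apply/funext=> n; rewrite coef_degexpm1 //.
case: n => [|n]; first by rewrite big_ord0.
rewrite /= big_add1 big_mkord scaler_sumr; apply: eq_bigr => k _.
(* The factor x is constant in t, so the k-th power contributes ['X^k] times a scalar and the two
   sides can be compared for each k. *)
rewrite exprMn fpsCXn coef_fpsCM coef_degexpm1_fpsX_exp // -scalerAr mulr1.
under eq_bigr do rewrite -scaler_suml.
rewrite -scaler_suml !scalerA; congr (_ *: _).
(* For fixed n and k the summand is a product of a factor in i and a factor in j, so the double sum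
   factors. *)
have -> : \sum_(0 <= i < k.+1) \sum_(0 <= j < (n.+1 - k.+1).+1)
    ((stirling1 n.+1 (n.+1 - j))%:R * (stirling2 (n.+1 - j) k.+1)%:R
     * (stirling1 k.+1 (k.+1 - i))%:R
     * alpha ^+ (k.+1 - 1 - i) * beta ^+ i
     * lambda ^+ (n.+1 - k.+1 - j) * mu ^+ j)
  = rising alpha beta k.+1 * stirling12 lambda mu n.+1 k.+1.
  rewrite rising_rev stirling12_rev // big_distrl; apply: eq_bigr => i _ /=.
  rewrite mulr_sumr; apply: eq_bigr => j _; rewrite subn1 /=; ring.
(* The k! dividing [rising] cancels the k! from the coefficient of g^k, leaving 1/n!. *)
by field; rewrite !natf_fact_neq0.
Qed.
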